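(* Let $n\ge1$ and let $U$ be the unitary of any CNOT circuit on $n$ qubits. Then the controlled unitary $c(U)$ can be implemented with Toffoli-depth at most $12$ and Toffoli-count at most $2n$, without ancillas.
   Context: A CNOT circuit on $n$ qubits is a product of CNOT gates. For a unitary $U$ on $n$ qubits, $c(U)$ is the unitary on $n+1$ qubits with $c(U)(|0\rangle\otimes|\psi\rangle)=|0\rangle\otimes|\psi\rangle$ and $c(U)(|1\rangle\otimes|\psi\rangle)=|1\rangle\otimes U|\psi\rangle$. The implementation is a unitary circuit (no measurements) acting only on the $n+1$ qubits of $c(U)$, consisting of Clifford gates (generated by $H$, $S$, CNOT; any number, not counted) and Toffoli gates on any three qubits. Its Toffoli-count is its number of Toffoli gates. It has Toffoli-depth at most $D$ if it can be written as an alternating product $K_D L_D K_{D-1}\cdots K_1L_1K_0$ where each $K_j$ is a Clifford circuit and each $L_j$ is a product of Toffoli gates acting on pairwise disjoint sets of qubits. *)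

(* Defs.v *)
From mathcomp Require Import all_boot all_order all_algebra.

Set Implicit Arguments.
Unset Strict Implicit.
Unset Printing Implicit Defensive.

Import Order.TTheory GRing.Theory Num.Theory.
Local Open Scope ring_scope.

Definition bits (n : nat) := {ffun 'I_n -> bool}.

(* Operators on n qubits are written in the computational basis, whose vectors
   |x> are numbered by [enum_rank x]. *)
Notation operator C n := 'M[C]_#|{: bits n}|.
Notation qstate C n := 'cV[C]_#|{: bits n}|.

Definition op (C : numClosedFieldType) (n : nat) (f : bits n -> bits n -> C) :
    operator C n :=
  \matrix_(i, j) f (enum_val i) (enum_val j).

Section Gates.
Variables (C : numClosedFieldType) (n : nat).

(* 1 (x) ... (x) g (x) ... (x) 1 with the one-qubit operator g, given by its
   entries <a|g|b>, at position i. *)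
Definition one_qubit_mx (g : bool -> bool -> C) (i : 'I_n) : operator C n :=
  op (fun x y => if [forall k, (k != i) ==> (x k == y k)]
                 then g (x i) (y i) else 0).

Definition perm_op (f : bits n -> bits n) : operator C n :=
  op (fun x y => (x == f y)%:R).

Definition hadamard_entry (a b : bool) : C := (sqrtC 2)^-1 * (-1) ^+ (a && b).

Definition phase_entry (a b : bool) : C :=
  if a == b then (if a then 'i else 1) else 0.

Definition flip_if (b : bool) (t : 'I_n) (x : bits n) : bits n :=
  [ffun k => if k == t then x k (+) b else x k].

End Gates.

Inductive gate (n : nat) : Type :=
| Hgate of 'I_n
| Sgate of 'I_n
| CNOT (c t : 'I_n) of c != t
| Toffoli (c1 c2 t : 'I_n) of uniq [:: c1; c2; t].

Definition gate_mx (C : numClosedFieldType) (n : nat) (g : gate n) :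
    operator C n :=
  match g with
  | Hgate i => one_qubit_mx (@hadamard_entry C) i
  | Sgate i => one_qubit_mx (@phase_entry C) i
  | @CNOT _ c t _ => perm_op C (fun x => flip_if (x c) t x)
  | @Toffoli _ c1 c2 t _ => perm_op C (fun x => flip_if (x c1 && x c2) t x)
  end.

Definition is_cnot n (g : gate n) := if g is CNOT _ _ _ then true else false.
Definition is_toffoli n (g : gate n) :=
  if g is Toffoli _ _ _ _ then true else false.
Definition is_clifford n (g : gate n) := ~~ is_toffoli g.

Definition gate_qubits n (g : gate n) : {set 'I_n} :=
  match g with
  | Hgate i | Sgate i => [set i]
  | @CNOT _ c t _ => [set c; t]
  | @Toffoli _ c1 c2 t _ => [set c1; c2; t]
  end.

(* Circuits are listed in the order of the operator product: the last gate of
   the list is applied first. *)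
Definition circuit (n : nat) := seq (gate n).

Definition circuit_mx (C : numClosedFieldType) n (c : circuit n) :
    operator C n :=
  \prod_(g <- c) gate_mx C g.

Definition cnot_circuit n (c : circuit n) := all (@is_cnot n) c.
Definition clifford_circuit n (c : circuit n) := all (@is_clifford n) c.

Definition toffoli_layer n (c : circuit n) :=
  all (@is_toffoli n) c &&
  pairwise (fun g h => [disjoint gate_qubits g & gate_qubits h]) c.

Definition toffoli_count n (c : circuit n) := count (@is_toffoli n) c.

(* c = K_d L_d K_(d-1) ... K_1 L_1 K_0 with d <= D, where
   s = [:: (K_d, L_d); ...; (K_1, L_1)]. *)
Definition toffoli_depth_le n (D : nat) (c : circuit n) : Prop :=
  exists (s : seq (circuit n * circuit n)) (K0 : circuit n),
    [/\ (size s <= D)%N,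
        all (fun KL => clifford_circuit KL.1 && toffoli_layer KL.2) s,
        clifford_circuit K0
      & c = flatten [seq KL.1 ++ KL.2 | KL <- s] ++ K0].

(* On n.+1 qubits the control is qubit [ord0] and qubit i of the target
   register is [lift ord0 i]. *)
Definition target_bits n (x : bits n.+1) : bits n :=
  [ffun i => x (lift ord0 i)].

Definition controlled (C : numClosedFieldType) n (U : operator C n) :
    operator C n.+1 :=
  op (fun x y =>
    if x ord0 != y ord0 then 0
    else if x ord0
         then U (enum_rank (target_bits x)) (enum_rank (target_bits y))
         else (target_bits x == target_bits y)%:R).

(* |b> (x) |psi> *)
Definition ket_tens (C : numClosedFieldType) n (b : bool) (psi : qstate C n) :
    qstate C n.+1 :=
  \col_i (let x : bits n.+1 := enum_val i in
          if x ord0 == b then psi (enum_rank (target_bits x)) 0 else 0).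

Lemma controlled_tens (C : numClosedFieldType) n (U : operator C n) b
    (psi : qstate C n) :
  controlled U *m ket_tens b psi = ket_tens b (if b then U *m psi else psi).
Proof.
pose ext (y : bits n) : bits n.+1 :=
  [ffun i => oapp y b (unlift ord0 i)].
have ext0 y : ext y ord0 = b by rewrite ffunE unlift_none.
have extK y : target_bits (ext y) = y.
  by apply/ffunP=> i; rewrite !ffunE liftK.
have extV (x : bits n.+1) : x ord0 = b -> ext (target_bits x) = x.
  move=> xb; apply/ffunP=> i; rewrite ffunE.
  by case: unliftP => [j ->|->] /=; rewrite ?ffunE.
apply/colP=> i; rewrite !mxE /=; pose x : bits n.+1 := enum_val i; rewrite -/x.
rewrite (reindex (@enum_rank (bits n.+1))) /=; last first.
  exact/onW_bij/enum_rank_bij.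
rewrite (bigID (fun y : bits n.+1 => y ord0 == b)) /= [X in _ + X]big1 ?addr0.
  2:{ by move=> y /negPf yb; rewrite !mxE /= !enum_rankK yb mulr0. }
rewrite (reindex_onto ext (@target_bits n)) /=; last by move=> y /eqP /extV.
rewrite (eq_bigl xpredT); last by move=> y; rewrite ext0 extK !eqxx.
under eq_bigr => y _ do
  rewrite !mxE /= !enum_rankK !ext0 !eqxx !extK -/x.
case: (eqVneq (x ord0) b) => [xb | _]; last first.
  by rewrite big1 // => y _; rewrite mul0r.
rewrite xb; case: b ext ext0 extK extV xb => ext ext0 extK extV xb.
  rewrite mxE [RHS](reindex (@enum_rank (bits n))) //=.
  exact/onW_bij/enum_rank_bij.
rewrite (bigD1 (target_bits x)) //= eqxx mul1r big1 ?addr0 // => y.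
by rewrite eq_sym => /negPf ->; rewrite mul0r.
Qed.

(* Main.v *)
(* A controlled transvection is one Toffoli gate up to conjugation by CNOT
   gates, and conjugating A in GL_n(F_2) is free. V splits into cyclic summands;
   on a summand of dimension d, A is a companion matrix, hence a product of a
   transvection and two reflections of a d-cycle, that is of three involutions
   E_i with sum of rank(E_i - 1) at most d. So A = E_1 E_2 E_3 with
   the sum of the ranks m_i of E_i - 1 at most n. Each E_i is conjugate to m_i
   disjoint transvections, whose controlled versions only share the control.
   Half of the pairs lend their qubits, in an arbitrary state, as copies of the
   control for the other half, and conversely; this realises c(E_i) with 4
   layers and 2 m_i Toffoli gates. *)
Require Import Defs.
From mathcomp Require Import all_boot all_order all_algebra.
From mathcomp Require Import reals complex zify.

Local Open Scope ring_scope.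
Local Open Scope complex_scope.

Set Implicit Arguments.
Unset Strict Implicit.
Unset Printing Implicit Defensive.

Import GRing.Theory.

(** * Involutions over the field with two elements, and products of three of them *)

Lemma addmxb_self m n (A : 'M[bool]_(m, n)) : A + A = 0.
Proof. by apply/matrixP=> i j; rewrite !mxE; case: (A i j). Qed.

Lemma oppmxb m n (A : 'M[bool]_(m, n)) : - A = A.
Proof. by apply/eqP; rewrite eq_sym -addr_eq0 addmxb_self. Qed.

Definition involution_mx n (E : 'M[bool]_n) := E *m E == 1%:M.

(** For an involution this is the number of disjoint transvections to which it is conjugate, hence
    half of its Toffoli budget. *)
Definition residue n (E : 'M[bool]_n) := \rank (E - 1%:M).

Definition three_involutions n (A : 'M[bool]_n) : Prop :=
  exists E : 'I_3 -> 'M[bool]_n,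
    [/\ A = E 0 *m E 1 *m E 2, forall i, involution_mx (E i)
      & (\sum_i residue (E i) <= n)%N].

Lemma three_involutionsI n (E1 E2 E3 : 'M[bool]_n) :
  involution_mx E1 -> involution_mx E2 -> involution_mx E3 ->
  (residue E1 + residue E2 + residue E3 <= n)%N ->
  three_involutions (E1 *m E2 *m E3).
Proof.
move=> h1 h2 h3 hr.
exists (fun i : 'I_3 => nth E1 [:: E1; E2; E3] i); split=> //.
  by case=> [] [|[|[|]]].
by rewrite !big_ord_recl big_ord0 addn0 addnA.
Qed.

Lemma three_involutions_conj n (A P : 'M[bool]_n) :
  P \in unitmx -> three_involutions (P *m A *m invmx P) -> three_involutions A.
Proof.
move=> uP [E [eA hE hr]].
exists (fun i => invmx P *m E i *m P); split.
- rewrite -[LHS](mulKmx uP) -[_ *m A](mulmxKV uP) eA.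
  by rewrite !mulmxA !mulmxK.
- move=> i; rewrite /involution_mx !mulmxA mulmxK // -(mulmxA _ (E i) (E i)).
  by rewrite (eqP (hE i)) mulmx1 mulVmx.
- apply: leq_trans hr; apply: leq_sum => i _.
  rewrite /residue; have -> : invmx P *m E i *m P - 1%:M = invmx P *m (E i - 1%:M) *m P.
    by rewrite mulmxBr mulmxBl mulmx1 mulVmx.
  exact: leq_trans (mxrankM_maxl _ _) (mxrankM_maxr _ _).
Qed.

(** Needed to pass to the dual space when the longest free Krylov sequence belongs to the
    transpose. *)
Lemma three_involutions_tr n (A : 'M[bool]_n) :
  three_involutions A^T -> three_involutions A.
Proof.
move=> [E [eA hE hr]].
rewrite -[A]trmxK eA !trmx_mul mulmxA.
have hT i : involution_mx (E i)^T.
  by rewrite /involution_mx -trmx_mul (eqP (hE i)) trmx1.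
apply: three_involutionsI => //.
have rT i : residue (E i)^T = residue (E i).
  by rewrite /residue -mxrank_tr linearB /= trmxK trmx1.
move: hr; rewrite !rT !big_ord_recl big_ord0 addn0.
rewrite (_ : lift _ _ = 1); last exact/val_inj.
rewrite (_ : lift _ _ = 2); last exact/val_inj.
by apply: leq_trans; rewrite addnC (addnC (residue (E 2))).
Qed.

Lemma involution_mx_block m n (A : 'M[bool]_m) (B : 'M[bool]_n) :
  involution_mx A -> involution_mx B -> involution_mx (block_mx A 0 0 B).
Proof.
move=> /eqP hA /eqP hB; rewrite /involution_mx mulmx_block hA hB.
by rewrite !(mulmx0, mul0mx, addr0, add0r) -scalar_mx_block.
Qed.

Lemma residue_block m n (A : 'M[bool]_m) (B : 'M[bool]_n) :
  residue (block_mx A 0 0 B) = (residue A + residue B)%N.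
Proof.
rewrite /residue (scalar_mx_block m n) opp_block_mx add_block_mx !subr0.
exact: rank_diag_block_mx.
Qed.

Lemma three_involutions_block m n (A : 'M[bool]_m) (B : 'M[bool]_n) :
  three_involutions A -> three_involutions B ->
  three_involutions (block_mx A 0 0 B).
Proof.
move=> [E [eA hE rE]] [G [eB hG rG]].
exists (fun i => block_mx (E i) 0 0 (G i)); split.
- by rewrite !mulmx_block !(mulmx0, mul0mx, addr0, add0r) -eA -eB.
- by move=> i; apply: involution_mx_block.
- apply: leq_trans (leq_add rE rG); rewrite -big_split /=.
  by apply: leq_sum => i _; rewrite residue_block.
Qed.

Lemma involution_mx_sub1_sqr n (E : 'M[bool]_n) :
  involution_mx E -> (E - 1%:M) *m (E - 1%:M) = 0.
Proof.
move=> /eqP hE; rewrite oppmxb mulmxDl !mulmxDr mul1mx !mulmx1 hE.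
by rewrite [E + _]addrC addmxb_self.
Qed.

(** In characteristic 2, $(E-1)^2=0$, so the image of $E-1$ lies in its kernel and twice its rank is
    at most $n$. *)
Lemma involution_mx_rank n (E : 'M[bool]_n) :
  involution_mx E -> (residue E <= n./2)%N.
Proof.
move=> /involution_mx_sub1_sqr /mulmx0_rank_max.
by rewrite -/(residue E) addnn => h; rewrite -(doubleK (residue _)) half_leq.
Qed.

(** * Companion matrices *)

Definition reversal_mx n : 'M[bool]_n := \matrix_(i, j) (j == rev_ord i)%:R.

Lemma row_reversal_mx n (i : 'I_n) :
  row i (reversal_mx n) = delta_mx 0 (rev_ord i).
Proof. by apply/rowP=> j; rewrite !mxE. Qed.

Lemma row_reversal_mx_block m n (i : 'I_n) :
  row (rshift m i) (block_mx (1%:M : 'M_m) 0 0 (reversal_mx n)) =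
  delta_mx 0 (rshift m (rev_ord i)).
Proof.
rewrite rowKd row_row_mx row0 row_reversal_mx.
apply/rowP=> j; rewrite !mxE; case: split_ordP => k ->; rewrite !mxE.
  by rewrite eq_lrshift.
by rewrite eq_rshift.
Qed.

Lemma reversal_mx_involution n : involution_mx (reversal_mx n).
Proof.
apply/eqP/row_matrixP => i.
by rewrite row_mul row_reversal_mx -rowE row_reversal_mx rev_ordK row1.
Qed.

(* A companion matrix is the cyclic shift up to its last row, the shift is the
   product of two reflections of the cycle, of ranks floor(d/2) and
   floor((d-1)/2), and the last row costs one transvection. *)
Lemma companion_three_involutions d (C : 'M[bool]_d) :
  C \in unitmx ->
  (forall i j : 'I_d, i.+1 = j :> nat -> row i C = delta_mx 0 j) ->
  three_involutions C.
Proof.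
case: d C => [|d] C uC hC.
  exists (fun=> 0); split=> [|i|]; first by rewrite !flatmx0.
    by apply/eqP; rewrite !flatmx0.
  by rewrite big1 // => i _; rewrite /residue flatmx0 mxrank0.
pose J := reversal_mx d.+1.
pose K : 'M[bool]_d.+1 := block_mx (1%:M : 'M_1) 0 0 (reversal_mx d).
have hJ : involution_mx J by exact: reversal_mx_involution.
have hK : involution_mx K.
  apply: (@involution_mx_block 1 d); last exact: reversal_mx_involution.
  by rewrite /involution_mx mulmx1.
(* On row indices [K] takes $i+1$ to $d-i$ and [J] takes that back to $i$, so [K *m J] undoes the
   shift and [X] differs from the identity in the last row only. *)
pose X := C *m K *m J.
have eC : C = X *m J *m K.
  by rewrite -(mulmxA (C *m K)) (eqP hJ) mulmx1 -mulmxA (eqP hK) mulmx1.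
have uI E : @involution_mx d.+1 E -> E \in unitmx.
  by move=> /eqP /mulmx1_unit [].
have uX : X \in unitmx by rewrite !unitmx_mul uC !uI.
have rowX (i : 'I_d.+1) : i != ord_max -> row i X = row i 1%:M.
  move=> ne_i; have lt_i : (i < d)%N.
    by rewrite ltn_neqAle -ltnS ltn_ord andbT.
  rewrite /X !row_mul (hC i (rshift 1 (Ordinal lt_i))) //.
  rewrite -rowE (@row_reversal_mx_block 1 d) -rowE row_reversal_mx row1; congr delta_mx.
  by apply/val_inj; rewrite /= add1n subSS subnSK // subKn // ltnW.
pose w := row ord_max (X - 1%:M).
have eX : X - 1%:M = delta_mx ord_max 0 *m w.
  apply/row_matrixP => i; rewrite row_mul; case: (eqVneq i ord_max) => [->|ne_i].
    by apply/rowP => j; rewrite !mxE big_ord1 !mxE !eqxx mul1r.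
  rewrite linearB /= rowX // subrr; apply/rowP=> j.
  by rewrite !mxE big_ord1 !mxE (negPf ne_i) mul0r.
(* The value 1 would give [w *m X = w + w = 0], against the invertibility of [X]. With the value 0,
   [X - 1%:M] squares to 0. *)
have w0 : w *m delta_mx ord_max 0 = 0 :> 'M_1.
  apply/eqP; case: eqP => // w_neq0.
  have w1 : w *m delta_mx ord_max 0 = 1%:M :> 'M_1.
    move: w_neq0; rewrite [_ *m _]mx11_scalar; case: (_ 0 0) => // [[]].
    by apply/matrixP=> i j; rewrite !mxE mul0rn.
  have : w *m X = 0.
    by rewrite -[X](subrK 1%:M) eX mulmxDr mulmxA w1 mul1mx mulmx1 addmxb_self.
  move=> /(congr1 (mulmx^~ (invmx X))); rewrite mulmxK // mul0mx => w00.
  by case: w_neq0; rewrite w00 mul0mx.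
have hX : involution_mx X.
  rewrite /involution_mx -[X](subrK 1%:M) mulmxDl mulmxDr mul1mx mulmx1.
  rewrite {1 2}eX -mulmxA (mulmxA w) w0 mul0mx mulmx0 add0r addrA.
  by rewrite addmxb_self add0r.
rewrite eC; apply: three_involutionsI => //.
have rX : (residue X <= 1)%N.
  by rewrite /residue eX (leq_trans (mxrankM_maxr _ _)) // rank_leq_row.
have rJ := involution_mx_rank hJ.
have rK : (residue K <= d./2)%N.
  rewrite (@residue_block 1 d) /residue subrr mxrank0.
  exact/involution_mx_rank/reversal_mx_involution.
(* The size is [d.+1], and $1+\lfloor (d+1)/2\rfloor+\lfloor d/2\rfloor=d+1$. *)
apply: leq_trans (leq_add (leq_add rX rJ) rK) _.
by rewrite -addnA add1n ltnS -[d.+1./2]/(uphalf d) uphalf_half -addnA addnn odd_double_half.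
Qed.

(** * Krylov sequences and the splitting into cyclic summands *)

Lemma trmx_exp n (A : 'M[bool]_n) i : (A ^+ i)^T = A^T ^+ i.
Proof.
by elim: i => [|i IH]; [rewrite trmx1 | rewrite exprS trmx_mul IH exprSr].
Qed.

Definition krylov_mx n (A : 'M[bool]_n) d (v : 'rV[bool]_n) : 'M[bool]_(d, n) :=
  \matrix_(i < d) (v *m A ^+ i).

Lemma row_krylov_mx n (A : 'M[bool]_n) d v (i : 'I_d) :
  row i (krylov_mx A d v) = v *m A ^+ i.
Proof. exact: rowK. Qed.

Lemma row_krylov_mxM n (A : 'M[bool]_n) d v (i : 'I_d) :
  row i (krylov_mx A d v *m A) = v *m A ^+ i.+1.
Proof. by rewrite row_mul rowK -mulmxA exprSr. Qed.

(** The longer sequence contains both [K] and [K *m A]; not being free, it has rank at most $d$, so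
    it spans no more than [K]. *)
Lemma krylov_mx_stable n (A : 'M[bool]_n) d v :
  row_free (krylov_mx A d v) -> ~~ row_free (krylov_mx A d.+1 v) ->
  (krylov_mx A d v *m A <= krylov_mx A d v)%MS.
Proof.
set K := krylov_mx A d v; set K' := krylov_mx A d.+1 v => fK nfK'.
have sK : (K <= K')%MS.
  apply/row_subP => i; rewrite row_krylov_mx.
  by apply: (eq_row_sub (widen_ord (leqnSn d) i)); rewrite row_krylov_mx.
have sKA : (K *m A <= K')%MS.
  apply/row_subP => i; rewrite row_krylov_mxM.
  by apply: (eq_row_sub (lift ord0 i)); rewrite row_krylov_mx.
apply: (submx_trans sKA).
rewrite -(geq_leqif (mxrank_leqif_sup sK)) (eqP fK) -ltnS.
by rewrite ltn_neqAle nfK' rank_leq_row.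
Qed.

(** In the Krylov basis the restriction of [A] is a companion matrix, because [A] takes $vA^i$ to
    $vA^{i+1}$. *)
Lemma cyclic_basis_three_involutions n (A : 'M[bool]_n) d (C : 'M[bool]_d) v :
  row_free (krylov_mx A d v) -> C \in unitmx ->
  C *m krylov_mx A d v = krylov_mx A d v *m A -> three_involutions C.
Proof.
move=> fK uC eC; apply: companion_three_involutions => // i j eij.
apply: (row_free_inj fK).
by rewrite -row_mul eC row_krylov_mxM -rowE row_krylov_mx eij.
Qed.

(** The rows of [K] and [W] span complementary stable subspaces, so [A] is conjugate to a block
    diagonal matrix, whose blocks inherit invertibility. *)
Lemma three_involutions_split n d e (A : 'M[bool]_n) (K : 'M_(d, n))
    (W : 'M_(e, n)) (C : 'M_d) (B : 'M_e) :
  n = (d + e)%N -> row_free (col_mx K W) -> A \in unitmx ->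
  C *m K = K *m A -> B *m W = W *m A ->
  (C \in unitmx -> three_involutions C) ->
  (B \in unitmx -> three_involutions B) ->
  three_involutions A.
Proof.
move=> en; subst n; rewrite row_free_unit; set P := col_mx K W => uP uA eK eW hC hB.
have eP : P *m A *m invmx P = block_mx C 0 0 B.
  rewrite [P *m A](_ : _ = block_mx C 0 0 B *m P) ?mulmxK //.
  by rewrite mul_block_col !mul0mx addr0 add0r eK eW mul_col_mx.
have : P *m A *m invmx P \in unitmx by rewrite !unitmx_mul uP uA unitmx_inv.
rewrite eP block_diag_mx_unit => /andP[uC uB].
apply: (three_involutions_conj uP); rewrite eP.
by apply: three_involutions_block; [exact: hC | exact: hB].
Qed.

(* The complement of a cyclic subspace of maximal dimension is the annihilator
   of the cyclic subspace generated by a linear form in the dual space; the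
   latter is stable because it cannot have larger dimension either. *)
Lemma three_involutions_cyclic_summand n (A : 'M[bool]_n) d v :
  A \in unitmx -> row_free (krylov_mx A d.+1 v) ->
  (forall w, ~~ row_free (krylov_mx A d.+2 w)) ->
  (forall w, ~~ row_free (krylov_mx A^T d.+2 w)) ->
  (forall e, (e < n)%N ->
     forall B : 'M[bool]_e, B \in unitmx -> three_involutions B) ->
  three_involutions A.
Proof.
set K := krylov_mx A d.+1 v => uA fK maxA maxAT IH.
(* A linear form with value 1 on $vA^d$ and 0 on the earlier Krylov vectors. The columns of [L] are
   then $f, Af, \dots, A^df$. *)
pose f := col ord_max (pinvmx K).
pose L := (krylov_mx A^T d.+1 f^T)^T.
have KL (i j : 'I_d.+1) : (K *m L) i j = (v *m A ^+ (i + j) *m f) 0 0.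
  have -> : (K *m L) i j = (row i K *m col j L) 0 0.
    by rewrite !mxE; apply: eq_bigr => k _; rewrite !mxE.
  rewrite row_krylov_mx -tr_row row_krylov_mx trmx_mul trmxK trmx_exp trmxK.
  by rewrite mulmxA -(mulmxA v) exprD.
have Kf (i : 'I_d.+1) : (v *m A ^+ i *m f) 0 0 = (i == ord_max).
  rewrite -row_krylov_mx -/K /f colE mulmxA -row_mul mulmxVp // row1.
  by rewrite mul_delta_mx_cond; case: eqP => _; rewrite ?mulr1n ?mulr0n !mxE.
(* [K *m L] is the Hankel matrix $vA^{i+j}f$, which is 0 for $i+j<d$ and 1 for $i+j=d$. Reversing
   its rows makes it triangular with unit diagonal. *)
have uKL : K *m L \in unitmx.
  pose J := reversal_mx d.+1.
  suff : \det (J *m (K *m L)) != 0.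
    by rewrite det_mulmx mulf_eq0 negb_or unitmxE unitfE => /andP[].
  have KLn (i j : 'I_d.+1) : (i + j <= d)%N -> (K *m L) i j = (i + j == d)%N.
    by rewrite KL -ltnS => le_ij; rewrite (Kf (Ordinal le_ij)).
  have JM (i j : 'I_d.+1) : (J *m (K *m L)) i j = (K *m L) (rev_ord i) j.
    rewrite mxE (bigD1 (rev_ord i)) //= mxE eqxx mul1r big1 ?addr0 // => k.
    by rewrite mxE => /negPf ->; rewrite mul0r.
  rewrite -det_tr det_trig.
    rewrite big1 ?oner_eq0 // => i _.
    by rewrite mxE JM KLn /= subSS subnK ?eqxx // -ltnS.
  apply/is_trig_mxP => i j lt_ij; rewrite mxE JM KLn /= subSS.
    by apply/negbTE; have := ltn_ord j; lia.
  by have := ltn_ord j; lia.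
have fL : row_free (krylov_mx A^T d.+1 f^T).
  rewrite -[krylov_mx _ _ _]trmxK -/L; apply/row_freeP; exists (K^T *m (invmx (K *m L))^T).
  by rewrite mulmxA -!trmx_mul mulVmx // trmx1.
have [D eD] : exists D, A *m L = L *m D.
  have /submxP[D eD] := krylov_mx_stable fL (maxAT f^T).
  by exists D^T; apply: trmx_inj; rewrite !trmx_mul [L^T]trmxK trmxK.
pose W := row_base (kermx L).
have WL : W *m L = 0 by apply/sub_kermxP; rewrite eq_row_base.
have /submxP[C eC] := krylov_mx_stable fK (maxA v).
have /submxP[B eB] : (W *m A <= W)%MS.
  by rewrite eq_row_base; apply/sub_kermxP; rewrite -mulmxA eD mulmxA WL mul0mx.
have rk : \rank (kermx L) = (n - d.+1)%N.
  by rewrite mxrank_ker mxrank_tr (eqP fL).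
have dn : (d.+1 <= n)%N by rewrite -(eqP fK) rank_leq_col.
apply: (@three_involutions_split _ _ _ A K W C B) => //.
- by rewrite rk subnKC.
- have fW : row_free W by exact: row_base_free.
  (* Since [W *m L = 0], this product is block upper triangular with diagonal blocks [K *m L] and
     1. *)
  have : col_mx K W *m row_mx L (pinvmx W) \in unitmx.
    by rewrite mul_col_row WL (mulmxVp fW) unitmxE det_ublock det1 mulr1.
  move=> uKW; apply/row_freeP.
  exists (row_mx L (pinvmx W) *m invmx (col_mx K W *m row_mx L (pinvmx W))).
  by rewrite mulmxA mulmxV.
- by move=> uC; apply: cyclic_basis_three_involutions (esym eC).
- by apply: IH; rewrite rk ltn_subrL (leq_trans _ dn).
Qed.

(** Strong induction on the dimension. The maximal length of a free Krylov sequence is taken over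
    [A] and [A^T] together, so that maximality holds on both sides at once. *)
Lemma unitmx_three_involutions n (A : 'M[bool]_n) :
  A \in unitmx -> three_involutions A.
Proof.
elim/ltn_ind: n A => n IH A uA.
pose P d := [exists v, row_free (krylov_mx A d v) || row_free (krylov_mx A^T d v)].
have P0 : exists d, P d.
  by exists 0%N; apply/existsP; exists 0; rewrite /row_free flatmx0 mxrank0.
have Pn d : P d -> (d <= n)%N.
  by move=> /existsP[v /orP[]] /eqP <-; exact: rank_leq_col.
case: (ex_maxnP P0 Pn) => d /existsP[v Pv] maxd.
have maxP w : ~~ row_free (krylov_mx A d.+1 w) /\ ~~ row_free (krylov_mx A^T d.+1 w).
  apply/andP; rewrite -negb_or; apply/negP => Pw.
  have /maxd : P d.+1 by apply/existsP; exists w.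
  by rewrite ltnn.
have [n0|n_gt0] := posnP n.
  subst n; exists (fun=> 0); split=> [|i|]; first by rewrite !flatmx0.
    by apply/eqP; rewrite !flatmx0.
  by rewrite big1 // => i _; rewrite /residue flatmx0 mxrank0.
(* The maximum is positive, since a single nonzero vector is a free sequence of length 1. *)
case: d Pv maxd maxP => [|d] Pv maxd maxP.
  have [] := maxP (delta_mx 0 (Ordinal n_gt0)).
  rewrite /row_free eqn_leq rank_leq_row lt0n mxrank_eq0.
  case: eqP => // /(congr1 (row 0)); rewrite row_krylov_mx row0 [_ *m _]mulmx1.
  by move=> /matrixP/(_ 0 (Ordinal n_gt0)); rewrite !mxE !eqxx.
have [m1 m2] := all_and2 maxP.
case/orP: Pv => fK.
  by apply: (@three_involutions_cyclic_summand _ A d v).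
apply: three_involutions_tr.
apply: (@three_involutions_cyclic_summand _ A^T d v); rewrite ?unitmx_tr ?trmxK //.
Qed.

(** * Classical circuits and the calculus of Toffoli-depth *)

Definition gate_fun n (g : gate n) (x : bits n) : bits n :=
  match g with
  | @CNOT _ c t _ => flip_if (x c) t x
  | @Toffoli _ c1 c2 t _ => flip_if (x c1 && x c2) t x
  | _ => x
  end.

Definition circuit_fun n (c : circuit n) (x : bits n) : bits n :=
  foldr (@gate_fun n) x c.

Lemma circuit_fun_cat n (c d : circuit n) x :
  circuit_fun (c ++ d) x = circuit_fun c (circuit_fun d x).
Proof. exact: foldr_cat. Qed.

(** The gates for which [gate_fun] is the true action on basis states; on [Hgate] and [Sgate] its
    value is only a default. *)
Definition is_classical n (g : gate n) := is_cnot g || is_toffoli g.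

Lemma cnot_classical n (c : circuit n) :
  cnot_circuit c -> all (@is_classical n) c.
Proof. by apply: sub_all => g; rewrite /is_classical => ->. Qed.

Lemma cnot_clifford n (c : circuit n) : cnot_circuit c -> clifford_circuit c.
Proof. by apply: sub_all => -[]. Qed.

Lemma cnot_toffoli_count n (c : circuit n) :
  cnot_circuit c -> toffoli_count c = 0%N.
Proof.
move=> /cnot_clifford hc; apply/eqP; rewrite eqn0Ngt -has_count.
by rewrite -all_predC.
Qed.

Lemma perm_op_comp (C : numClosedFieldType) n (f g : bits n -> bits n) :
  perm_op C f *m perm_op C g = perm_op C (f \o g).
Proof.
apply/matrixP=> i j; rewrite !mxE (bigD1 (enum_rank (g (enum_val j)))) //=.
rewrite !mxE enum_rankK eqxx mulr1 big1 ?addr0 // => k.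
rewrite !mxE; case: (eqVneq (enum_val k) (g _)) => [<-|_ _]; last by rewrite mulr0.
by rewrite enum_valK eqxx.
Qed.

Lemma perm_op_id (C : numClosedFieldType) n : perm_op C (@id (bits n)) = 1%:M.
Proof. by apply/matrixP=> i j; rewrite !mxE (inj_eq enum_val_inj). Qed.

Lemma circuit_mx_classical (C : numClosedFieldType) n (c : circuit n) :
  all (@is_classical n) c -> circuit_mx C c = perm_op C (circuit_fun c).
Proof.
rewrite /circuit_mx; elim: c => [_|g c IH /= /andP[cg /IH ec]].
  by rewrite big_nil -[LHS](perm_op_id C n).
rewrite big_cons ec [LHS](_ : _ = gate_mx C g *m perm_op C (circuit_fun c)) //.
rewrite (_ : gate_mx C g = perm_op C (gate_fun g)) ?perm_op_comp //.
by case: g cg.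
Qed.

Lemma depth_le_clifford n (c : circuit n) :
  clifford_circuit c -> toffoli_depth_le 0 c.
Proof. by move=> hc; exists [::], c. Qed.

Lemma depth_le_layer n (c : circuit n) : toffoli_layer c -> toffoli_depth_le 1 c.
Proof.
by move=> hc; exists [:: ([::], c)], [::]; split; rewrite //= ?cats0 ?hc.
Qed.

(** The trailing Clifford circuit of one factor merges with the leading one of the other, so depths
    just add. *)
Lemma depth_le_cat n (c d : circuit n) a b :
  toffoli_depth_le a c -> toffoli_depth_le b d -> toffoli_depth_le (a + b) (c ++ d).
Proof.
move=> [s [K [le_s hs hK ->]]] [[|[K' L'] s'] [J [le_s' hs' hJ ->]]].
  exists s, (K ++ J); split; rewrite /= ?catA ?cats0 //.
    exact: leq_trans le_s (leq_addr _ _).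
  by rewrite /clifford_circuit all_cat; apply/andP; split.
move: hs' => /= /andP[/andP[hK' hL'] hs'].
exists (s ++ (K ++ K', L') :: s'), J; split=> //.
- by rewrite size_cat leq_add.
- by rewrite all_cat hs /= hL' hs' !andbT /clifford_circuit all_cat; apply/andP; split.
- by rewrite map_cat flatten_cat /= !catA.
Qed.

Lemma depth_le_mono n (c : circuit n) a b :
  (a <= b)%N -> toffoli_depth_le a c -> toffoli_depth_le b c.
Proof.
by move=> le_ab [s [K [le_s hs hK ec]]]; exists s, K; split=> //; apply: leq_trans le_ab.
Qed.

(** * Fan-out and controlled additions with borrowed qubits *)

Lemma fan_out n (b : 'I_n) (s : seq 'I_n) :
  uniq (b :: s) ->
  exists2 c : circuit n, cnot_circuit c
    & forall x k, circuit_fun c x k = x k + x b * (k \in s).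
Proof.
elim: s => [_|d s IH]; first by exists [::] => // x k; rewrite mulr0 addr0.
rewrite /= inE negb_or => /andP[/andP[ne_bd b_s] /andP[d_s u_s]].
have [|c hc ec] := IH; first by rewrite /= b_s.
(* One CNOT per target. On [bool], addition is exclusive or and multiplication is conjunction. *)
exists (CNOT ne_bd :: c) => // x k.
rewrite /= ffunE !ec inE (negPf b_s) mulr0 addr0.
by case: (eqVneq k d) => //= ->; rewrite (negPf d_s) mulr0 mulr1 addr0.
Qed.

(** Uniqueness of the flattened list says at once that each tuple has distinct entries and that
    different tuples are disjoint. *)
Definition flat2 (T : Type) (s : seq (T * T)) :=
  flatten [seq [:: p.1; p.2] | p <- s].
Definition flat3 (T : Type) (s : seq (T * (T * T))) :=
  flatten [seq [:: p.1; p.2.1; p.2.2] | p <- s].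

Lemma flat2_cat T (s t : seq (T * T)) : flat2 (s ++ t) = flat2 s ++ flat2 t.
Proof. by rewrite /flat2 map_cat flatten_cat. Qed.

Lemma size_flat2 T (s : seq (T * T)) : size (flat2 s) = (size s).*2.
Proof. by elim: s => //= p s ->. Qed.

Lemma perm_flat2 (T : eqType) (s : seq (T * T)) :
  perm_eq (flat2 s) (unzip1 s ++ unzip2 s).
Proof.
elim: s => //= -[a b] s IH /=; rewrite perm_cons perm_sym.
by rewrite (perm_catCA _ [:: b]) perm_cons perm_sym.
Qed.

Lemma perm_flat3_zip (T : eqType) (d : seq T) (s : seq (T * T)) :
  size d = size s -> perm_eq (flat3 (zip d s)) (d ++ flat2 s).
Proof.
elim: d s => [|a d IH] [|p s] //= [/IH h]; rewrite perm_cons perm_sym.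
by rewrite (perm_catCA _ [:: p.1; p.2]) !perm_cons perm_sym.
Qed.

Lemma mem_flat2 (T : eqType) (s : seq (T * T)) p :
  p \in s -> (p.1 \in flat2 s) /\ (p.2 \in flat2 s).
Proof.
by move=> ps; split; apply/flattenP; exists [:: p.1; p.2]; rewrite ?map_f // !inE eqxx ?orbT.
Qed.

Lemma mem_flat3 (T : eqType) (s : seq (T * (T * T))) p :
  p \in s -> [/\ p.1 \in flat3 s, p.2.1 \in flat3 s & p.2.2 \in flat3 s].
Proof.
by move=> ps; split; apply/flattenP; exists [:: p.1; p.2.1; p.2.2];
  rewrite ?map_f // !inE eqxx ?orbT.
Qed.

(** A triple [(d, (c, t))] stands for the Toffoli gate with controls [d], [c] and target [t].
    Disjoint gates do not see each other, so every contribution is read off the initial state. *)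
Lemma toffoli_layer_triples n (s : seq ('I_n * ('I_n * 'I_n))) :
  uniq (flat3 s) ->
  exists c : circuit n, [/\ toffoli_layer c, size c = size s
    & forall x k, circuit_fun c x k =
        x k + \sum_(p <- s | p.2.2 == k) x p.1 * x p.2.1].
Proof.
(* The induction must also record where the gates act, to make the next gate disjoint from them. *)
suff H : uniq (flat3 s) -> exists c : circuit n,
    [/\ toffoli_layer c, size c = size s,
        all (fun g => gate_qubits g \subset [set i in flat3 s]) c
      & forall x k, circuit_fun c x k =
          x k + \sum_(p <- s | p.2.2 == k) x p.1 * x p.2.1].
  by move=> /H [c [? ? _ ?]]; exists c.
elim: s => [_|[d [c t]] s IH].
  by exists [::]; split=> // x k; rewrite big_nil addr0.
rewrite -[flat3 _]/([:: d; c; t] ++ flat3 s) cat_uniq => /and3P[u_dct dis u_s].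
have [L [/andP[tL pL] sL qL eL]] := IH u_s.
exists (Toffoli u_dct :: L); split=> /=.
- rewrite /toffoli_layer /= tL pL andbT; apply: sub_all qL => g sg.
  apply: disjointWr sg _; rewrite disjoint_subset; apply/subsetP=> i.
  rewrite !inE => hi; apply: contra dis => i_s; apply/hasP; exists i => //.
  by rewrite !inE orbA.
- by rewrite sL.
- apply/andP; split.
    by apply/subsetP=> i; rewrite !inE -orbA => /or3P[] ->; rewrite ?orbT.
  apply: sub_all qL => g /subset_trans; apply; apply/subsetP=> i.
  by rewrite !inE => ->; rewrite !orbT.
- have out x i : i \in [:: d; c; t] -> circuit_fun L x i = x i.
    move=> hi; rewrite eL big_hasC ?addr0 //; apply: contra dis.
    move=> /hasP[p ps /eqP pi]; apply/hasP; exists i => //.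
    by have [_ _] := mem_flat3 ps; rewrite pi.
  move=> x k; rewrite big_cons ffunE /= (out x d) ?(out x c) ?inE ?eqxx ?orbT //.
  rewrite eL eq_sym; case: (t == k) => //=.
  by rewrite -[LHS]/(_ + x d * x c) -addrA; congr (_ + _); rewrite addrC.
Qed.

(* [t += b c] is realised on many disjoint pairs at once, although all of them
   share the control [b], by borrowing a qubit [d] in an arbitrary state for
   each pair: t += d c; d += b; t += d c; d += b. *)
Lemma borrowed_controlled_pairs n (b : 'I_n) (s : seq ('I_n * ('I_n * 'I_n))) :
  uniq (b :: flat3 s) ->
  exists c : circuit n, [/\ all (@is_classical n) c, toffoli_depth_le 2 c,
      (toffoli_count c <= 2 * size s)%N
    & forall x k, circuit_fun c x k =
        x k + \sum_(p <- s | p.2.2 == k) x b * x p.2.1].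
Proof.
rewrite /= => /andP[b_s u_s].
have [L [hL sL eL]] := toffoli_layer_triples u_s.
have perm_s : perm_eq (flat3 s) (unzip1 s ++ unzip1 (unzip2 s) ++ unzip2 (unzip2 s)).
  rewrite -[in flat3 _](zip_unzip s).
  apply: perm_trans (perm_flat3_zip _) _; first by rewrite !size_map.
  by rewrite perm_cat2l perm_flat2.
move: (u_s); rewrite (perm_uniq perm_s) !cat_uniq has_cat negb_or.
move=> /and3P[u1 /andP[/hasPn d_c /hasPn d_t] /and3P[_ /hasPn c_t _]].
have u_d : uniq (b :: unzip1 s).
  rewrite /= u1 andbT; apply: contra b_s; rewrite (perm_mem perm_s) mem_cat.
  by move=> ->.
have [F hF eF] := fan_out u_d.
have cL : all (@is_classical n) L.
  by case/andP: hL => + _; apply: sub_all => g; rewrite /is_classical orbC => ->.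
have eLo x k : (forall p, p \in s -> p.2.2 != k) -> circuit_fun L x k = x k.
  by move=> hk; rewrite eL big_hasC ?addr0 //; apply/hasPn => p /hk.
have target_notin p q : p \in s -> q \in s -> (p.2.2 != q.1) /\ (p.2.2 != q.2.1).
  move=> ps qs; have pt : p.2.2 \in unzip2 (unzip2 s) by rewrite !map_f.
  split; [have := d_t _ pt | have := c_t _ pt]; apply: contraNneq => ->.
    by rewrite /= map_f.
  by rewrite /= !map_f.
exists (F ++ L ++ F ++ L); split.
- by rewrite !all_cat cL !cnot_classical.
- have dF := depth_le_clifford (cnot_clifford hF).
  have dL := depth_le_layer hL.
  exact: depth_le_cat dF (depth_le_cat dL (depth_le_cat dF dL)).
- rewrite /toffoli_count !count_cat -!/(toffoli_count _) cnot_toffoli_count //.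
  have cs : (toffoli_count L <= size s)%N by rewrite -sL count_size.
  by rewrite !add0n mul2n -addnn leq_add.
- move=> x k.
  have Lb y : circuit_fun L y b = y b.
    apply: eLo => p ps; apply: contra b_s => /eqP <-.
    by have [] := mem_flat3 ps.
  have Fb y : circuit_fun F y b = y b.
    by have := u_d; rewrite eF /= => /andP[/negPf -> _]; rewrite mulr0 addr0.
  have Ld y p : p \in s -> circuit_fun L y p.1 = y p.1.
    by move=> ps; apply: eLo => q qs; have [] := target_notin _ _ qs ps.
  have Lc y p : p \in s -> circuit_fun L y p.2.1 = y p.2.1.
    by move=> ps; apply: eLo => q qs; have [] := target_notin _ _ qs ps.
  have Fd y p : p \in s -> circuit_fun F y p.1 = y p.1 + y b.
    by move=> ps; rewrite eF (map_f fst ps) mulr1.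
  have Fc y p : p \in s -> circuit_fun F y p.2.1 = y p.2.1.
    move=> ps; rewrite eF [_ \in _](negbTE (d_c _ _)) ?mulr0 ?addr0 //.
    by rewrite !map_f.
  rewrite !circuit_fun_cat eF Lb Fb Lb eL eF Lb eL.
  (* The two uses of [L] contribute $dc$ and $(d+b)c$, with sum $bc$; the two fan-outs cancel. *)
  set S := \sum_(_ <- _ | _) _; set S' := \sum_(_ <- _ | _) _.
  have -> : S' = \sum_(p <- s | p.2.2 == k) (x p.1 + x b) * x p.2.1.
    rewrite /S' big_seq_cond [RHS]big_seq_cond; apply: eq_bigr => p /andP[ps _].
    by rewrite Fd // Fc // Ld // Lc // Lb.
  have -> : \sum_(p <- s | p.2.2 == k) x b * x p.2.1 =
            S + \sum_(p <- s | p.2.2 == k) (x p.1 + x b) * x p.2.1.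
    rewrite -big_split /=; apply: eq_bigr => p _.
    by case: (x b) (x p.1) (x p.2.1) => [] [] [].
  by case: (x k) (S) (\sum_(_ <- _ | _) _) (x b * _) => [] [] [] [].
Qed.

(** Each half of the pairs borrows qubits of the other half, at two layers per half. A single pair
    has none to borrow and is one Toffoli gate. *)
Lemma controlled_pairs n (b : 'I_n) (s : seq ('I_n * 'I_n)) :
  uniq (b :: flat2 s) ->
  exists c : circuit n, [/\ all (@is_classical n) c, toffoli_depth_le 4 c,
      (toffoli_count c <= 2 * size s)%N
    & forall x k, circuit_fun c x k =
        x k + \sum_(p <- s | p.2 == k) x b * x p.1].
Proof.
have group (t : seq ('I_n * 'I_n)) (d : seq 'I_n) :
    (size t <= size d)%N -> uniq (b :: d ++ flat2 t) ->
  exists c : circuit n, [/\ all (@is_classical n) c, toffoli_depth_le 2 c,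
      (toffoli_count c <= 2 * size t)%N
    & forall x k, circuit_fun c x k =
        x k + \sum_(p <- t | p.2 == k) x b * x p.1].
  move=> le_td u_td; set e := take (size t) d.
  have se : size e = size t by rewrite size_takel.
  have : uniq (b :: flat3 (zip e t)).
    rewrite /= (perm_mem (perm_flat3_zip se)) (perm_uniq (perm_flat3_zip se)).
    apply: (@subseq_uniq _ (b :: e ++ flat2 t) _ _ u_td).
    by rewrite /= eqxx cat_subseq // take_subseq.
  move=> /borrowed_controlled_pairs[c [hc dc cc ec]]; exists c; split=> //.
    by rewrite size_zip se minnn in cc.
  move=> x k; rewrite ec -[in RHS](@unzip2_zip _ _ e t) ?se //.
  by rewrite big_map.
case: s => [|[c0 t0] [|q s]] u_s.
- exists [::]; split=> //; first exact: (@depth_le_mono _ _ 0 4 isT (depth_le_clifford _)).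
  by move=> x k; rewrite big_nil addr0.
- have [L [hL sL eL]] := @toffoli_layer_triples n [:: (b, (c0, t0))] u_s.
  exists L; split.
  + by case/andP: hL => + _; apply: sub_all => g; rewrite /is_classical orbC => ->.
  + exact: (@depth_le_mono _ _ 1 4 isT (depth_le_layer hL)).
  + by rewrite (leq_trans (count_size _ _)) // sL.
  + by move=> x k; rewrite eL !big_cons !big_nil.
move: u_s; set w := _ :: _ :: s => u_w.
(* From $m=2$ pairs on, the smaller half offers enough qubits: $2\lfloor m/2\rfloor\ge\lceil
   m/2\rceil$. *)
have w_ge2 : (2 <= size w)%N by [].
rewrite -[w](cat_take_drop (size w)./2).
set s1 := take _ w; set s2 := drop _ w.
have sz1 : size s1 = (size w)./2 by rewrite size_takel // leq_half_double; lia.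
have sz2 : size s2 = (size w - (size w)./2)%N by rewrite size_drop.
have u12 : uniq (b :: flat2 s1 ++ flat2 s2) by rewrite -flat2_cat cat_take_drop.
have u21 : uniq (b :: flat2 s2 ++ flat2 s1).
  by rewrite /= mem_cat orbC -mem_cat uniq_catC.
have [|c1 [h1 d1 n1 e1]] := group s1 (flat2 s2) _ u21; first by rewrite size_flat2; lia.
have [|c2 [h2 d2 n2 e2]] := group s2 (flat2 s1) _ u12; first by rewrite size_flat2; lia.
have e2o x k : k \notin flat2 s2 -> circuit_fun c2 x k = x k.
  move=> hk; rewrite e2 big_hasC ?addr0 //; apply: contra hk => /hasP[p ps /eqP <-].
  by have [] := mem_flat2 ps.
move: u12; rewrite cons_uniq mem_cat negb_or cat_uniq => /andP[/andP[b1 b2] /and3P[_ dis _]].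
exists (c1 ++ c2); split.
- by rewrite all_cat h1 h2.
- exact: depth_le_cat d1 d2.
- by rewrite /toffoli_count count_cat size_cat mulnDr leq_add.
move=> x k; rewrite circuit_fun_cat e1 e2 (e2o _ _ b2) big_cat /=.
rewrite -addrA [X in _ = _ + X]addrC; congr (_ + (_ + _)).
rewrite big_seq_cond [RHS]big_seq_cond; apply: eq_bigr => p /andP[ps _]; rewrite e2o //.
by apply: contra dis => hp; apply/hasP; exists p.1 => //; have [] := mem_flat2 ps.
Qed.

(** * CNOT circuits for invertible linear maps *)

Definition bits_of n (v : 'cV[bool]_n) : bits n := [ffun i => v i 0].

Lemma bits_ofK n (x : bits n) : bits_of (\col_i x i) = x.
Proof. by apply/ffunP=> i; rewrite ffunE mxE. Qed.

Lemma bits_of_inj n : injective (@bits_of n).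
Proof.
by move=> v w /ffunP evw; apply/colP=> i; have := evw i; rewrite !ffunE.
Qed.

Definition cnot_realizable n (A : 'M[bool]_n) : Prop :=
  exists2 c : circuit n, cnot_circuit c
    & forall v, circuit_fun c (bits_of v) = bits_of (A *m v).

Lemma cnot_realizableM n (A B : 'M[bool]_n) :
  cnot_realizable A -> cnot_realizable B -> cnot_realizable (A *m B).
Proof.
move=> [c hc ec] [d hd ed]; exists (c ++ d).
  by rewrite /cnot_circuit all_cat; apply/andP; split.
by move=> v; rewrite circuit_fun_cat ed ec mulmxA.
Qed.

(** The matrix adds coordinate [k] to every coordinate in the support of [w], which is a fan-out;
    [w k 0 = 0] keeps the control out of the targets. *)
Lemma cnot_realizable_transvection n (k : 'I_n) (w : 'cV[bool]_n) :
  w k 0 = 0 -> cnot_realizable (1%:M + w *m delta_mx 0 k).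
Proof.
move=> wk; have [|c hc ec] := @fan_out n k (enum [pred i | w i 0]).
  by rewrite /= mem_enum inE wk enum_uniq.
exists c => // v; apply/ffunP=> i; rewrite ec mem_enum !ffunE inE.
rewrite mulmxDl mul1mx mxE -mulmxA -rowE; congr (_ + _).
by rewrite mxE big_ord1 mxE mulrC; case: (w i 0).
Qed.

Lemma transvectionK n (k : 'I_n) (w : 'cV[bool]_n) : w k 0 = 0 ->
  (1%:M + w *m delta_mx 0 k) *m (1%:M + w *m delta_mx 0 k) = 1%:M.
Proof.
move=> wk; rewrite mulmxDl !mulmxDr !mul1mx mulmx1 mulmxA -(mulmxA w) -rowE.
rewrite (_ : row k w = 0); last by apply/rowP=> j; rewrite !mxE (ord1 j).
by rewrite mulmx0 mul0mx addr0 -addrA addmxb_self addr0.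
Qed.

(** One elimination step: the row operation is its own inverse. *)
Lemma cnot_realizable_mulmxl n (k : 'I_n) (w : 'cV[bool]_n) (A : 'M[bool]_n) :
  w k 0 = 0 -> cnot_realizable ((1%:M + w *m delta_mx 0 k) *m A) ->
  cnot_realizable A.
Proof.
move=> wk hA; rewrite -[A]mul1mx -(transvectionK wk) -mulmxA.
exact: cnot_realizableM (cnot_realizable_transvection wk) hA.
Qed.

(* Gauss elimination: in [H], all but the last [k] columns are reduced. *)
Lemma unitmx_cnot_realizable n (A : 'M[bool]_n) :
  A \in unitmx -> cnot_realizable A.
Proof.
suff H k : (k <= n)%N -> forall A : 'M[bool]_n, A \in unitmx ->
    (forall j : 'I_n, (j < n - k)%N -> col j A = delta_mx j 0) ->
    cnot_realizable A.
  by move=> uA; apply: (H n) => // j; rewrite subnn.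
elim: k => [_|k IH lt_kn] {}A uA hA.
  exists [::] => // v; rewrite (_ : A = 1%:M) ?mul1mx //.
  apply/trmx_inj/row_matrixP => j.
  by rewrite -tr_col hA ?subn0 // trmx_delta trmx1 row1.
pose c : 'I_n := Ordinal (ltac:(lia) : (n - k.+1 < n)%N).
have step (B : 'M[bool]_n) : B \in unitmx ->
    (forall j : 'I_n, (j < c)%N -> col j B = delta_mx j 0) ->
    B c c = 1 -> cnot_realizable B.
  (* Once the pivot is 1, adding row [c] along [w] clears the rest of column [c] and leaves the
     reduced columns alone. *)
  move=> uB hB Bcc; pose w := col c B - delta_mx c 0.
  have wc : w c 0 = 0 by rewrite !mxE Bcc !eqxx.
  apply: (cnot_realizable_mulmxl wc); apply: (IH (ltnW lt_kn)).
    by rewrite unitmx_mul uB andbT; have [] := mulmx1_unit (transvectionK wc).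
  move=> j lt_j; have [->|ne_jc] := eqVneq j c.
    rewrite colE -mulmxA -colE mulmxDl mul1mx -mulmxA -rowE.
    rewrite (_ : row c (col c B) = 1%:M); last first.
      by apply/matrixP=> a b; rewrite !mxE Bcc !ord1.
    by rewrite mulmx1 /w addrA addmxb_self add0r oppmxb.
  have lt_jc : (j < c)%N.
    rewrite ltn_neqAle (inj_eq val_inj) ne_jc /=; move: lt_j => /=; lia.
  rewrite colE -mulmxA -colE hB // mulmxDl mul1mx -mulmxA mul_delta_mx_0.
    by rewrite mulmx0 addr0.
  by rewrite eq_sym.
case Acc: (A c c); first exact: step.
(* Otherwise $Ae_c$ is supported on indices $j<c$, where $Ae_j=e_j$. Then $A(Ae_c)=Ae_c$, so
   $Ae_c=e_c$, against the zero pivot. *)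
have [i lt_ci Aic] : exists2 i : 'I_n, (c < i)%N & A i c.
  apply/exists_inP; apply: contraFT (Acc); rewrite negb_exists_in => /forall_inP Ac0.
  have : A *m col c A = A *m delta_mx c 0.
    rewrite -colE -[RHS]mul1mx; apply/colP=> a; rewrite !mxE.
    apply: eq_bigr => j _; have [lt_jc|le_cj] := ltnP j c.
      have /colP/(_ a) := hA j lt_jc; rewrite !mxE andbT => ->.
      by rewrite (eq_sym a).
    suff -> : col c A j 0 = 0 by rewrite !mulr0.
    rewrite mxE; move: le_cj; rewrite leq_eqVlt => /predU1P[ecj|/Ac0/negbTE //].
    by rewrite -(val_inj ecj) Acc.
  move/(can_inj (mulKmx uA)) => /colP/(_ c).
  by rewrite !mxE !eqxx => ->.
(* Adding row [i] to row [c] puts a 1 at the pivot. *)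
pose w : 'cV[bool]_n := delta_mx c 0.
have wi : w i 0 = 0 by rewrite mxE -val_eqE /= gtn_eqF.
apply: (cnot_realizable_mulmxl wi); apply: step.
- by rewrite unitmx_mul uA andbT; have [] := mulmx1_unit (transvectionK wi).
- move=> j lt_j; rewrite colE -mulmxA -colE hA // mulmxDl mul1mx -mulmxA mul_delta_mx_0.
    by rewrite mulmx0 addr0.
  by rewrite -val_eqE /= gtn_eqF // (ltn_trans lt_j).
- rewrite mulmxDl mul1mx mxE Acc add0r -mulmxA -rowE mxE big_ord1 !mxE !eqxx mul1r.
  exact: Aic.
Qed.

(** * Circuits for controlled linear maps *)

Definition implementable n d m (A : 'M[bool]_n) : Prop :=
  exists c : circuit n.+1, [/\ all (@is_classical n.+1) c,
    toffoli_depth_le d c, (toffoli_count c <= m)%N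
    & forall (b : 'M[bool]_1) v, circuit_fun c (bits_of (col_mx b v)) =
        bits_of (col_mx b (if b 0 0 then A *m v else v))].

Lemma implementableM n d1 d2 m1 m2 (A B : 'M[bool]_n) :
  implementable d1 m1 A -> implementable d2 m2 B ->
  implementable (d1 + d2) (m1 + m2) (A *m B).
Proof.
move=> [c [hc dc mc ec]] [e [he de me ee]]; exists (c ++ e); split.
- by rewrite all_cat hc.
- exact: depth_le_cat.
- by rewrite /toffoli_count count_cat leq_add.
- by move=> b v; rewrite circuit_fun_cat ee ec; case: (b 0 0); rewrite ?mulmxA.
Qed.

(** The circuits for [P] and its inverse run without control and cancel when the control is off.
    Being CNOT circuits, they cost neither depth nor Toffoli gates. *)
Lemma implementable_conj n d m (A P : 'M[bool]_n) : P \in unitmx ->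
  implementable d m (P *m A *m invmx P) -> implementable d m A.
Proof.
move=> uP [c [hc dc mc ec]].
have real (Q : 'M[bool]_n) : Q \in unitmx ->
    exists2 q : circuit n.+1, cnot_circuit q
      & forall (b : 'M[bool]_1) v,
          circuit_fun q (bits_of (col_mx b v)) = bits_of (col_mx b (Q *m v)).
  move=> uQ; have : block_mx (1%:M : 'M[bool]_1) 0 0 Q \in unitmx.
    by rewrite block_diag_mx_unit unitmx1.
  move=> /(@unitmx_cnot_realizable (1 + n)) [q hq eq]; exists q => // b v.
  by rewrite eq mul_block_col !mul0mx mul1mx addr0 add0r.
have [p hp ep] := real _ uP.
have [q hq eq] := real (invmx P) (etrans (unitmx_inv P) uP).
exists (q ++ c ++ p); split.
- by rewrite !all_cat hc !cnot_classical.
- rewrite -[d]add0n -[d]addn0; apply: depth_le_cat.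
    exact/depth_le_clifford/cnot_clifford.
  apply: depth_le_cat => //; exact/depth_le_clifford/cnot_clifford.
- rewrite /toffoli_count !count_cat -!/(toffoli_count _).
  by rewrite (cnot_toffoli_count hp) (cnot_toffoli_count hq) addn0.
move=> b v; rewrite !circuit_fun_cat ep ec eq.
by case: (b 0 0); rewrite ?mulmxA ?mulKmx ?mulmxKV // mulVmx // mul1mx.
Qed.

(** With the identity added, this is the normal form of an involution of residue [m]: the first
    block is added to the second, and the last is a fixed remainder. *)
Definition shear_mx m k : 'M[bool]_(m + (m + k)) :=
  block_mx 0 0 (col_mx 1%:M 0) 0.

Lemma implementable_shear m k : implementable 4 (2 * m) (1%:M + shear_mx m k).
Proof.
(* [f i] and [g i] are the source and target qubits of the [i]-th transvection; [rshift 1] skips the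
   control. *)
pose f (i : 'I_m) : 'I_(1 + (m + (m + k))) := rshift 1 (lshift (m + k) i).
pose g (i : 'I_m) : 'I_(1 + (m + (m + k))) := rshift 1 (rshift m (lshift k i)).
pose s := [seq (f i, g i) | i <- enum 'I_m].
have [fi gi] : injective f /\ injective g.
  by split=> i j /(@rshift_inj 1 (m + (m + k))); [move/lshift_inj | move/rshift_inj/lshift_inj].
have fg i j : (g i == f j) = false.
  by rewrite (inj_eq (@rshift_inj 1 (m + (m + k)))) eq_rlshift.
have u_s : uniq (ord0 :: flat2 s).
  have perm_s := perm_flat2 s; rewrite cons_uniq (perm_uniq perm_s) (perm_mem perm_s).
  have [-> ->] : unzip1 s = map f (enum 'I_m) /\ unzip2 s = map g (enum 'I_m).
    by rewrite /unzip1 /unzip2 -!map_comp.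
  rewrite cat_uniq (map_inj_uniq fi) (map_inj_uniq gi) enum_uniq andbT /=.
  apply/andP; split.
    by rewrite mem_cat; apply/norP; split; apply/mapP=> -[].
  by apply/hasPn => _ /mapP[i _ ->]; apply/mapP=> -[j _ /eqP]; rewrite fg.
have [c [hc dc mc ec]] := controlled_pairs u_s.
exists c; split => //.
  by move: mc; rewrite size_map size_enum_ord.
move=> b v; rewrite -[v]vsubmxK -[dsubmx v]vsubmxK.
set v1 := usubmx v; set v2 := usubmx _; set v3 := dsubmx _.
have -> : (if b 0 0 then (1%:M + shear_mx m k) *m col_mx v1 (col_mx v2 v3)
           else col_mx v1 (col_mx v2 v3)) =
    col_mx v1 (col_mx (v2 + b 0 0 *: v1) v3).
  case: (b 0 0); last by rewrite scale0r addr0.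
  rewrite scale1r mulmxDl mul1mx mul_block_col !mul0mx !add0r.
  by rewrite addr0 mul_col_mx mul1mx mul0mx !add_col_mx !addr0.
apply/ffunP=> j; rewrite ec big_map.
set x : bits (1 + (m + (m + k))) := bits_of _.
have x0 : x ord0 = b 0 0.
  have -> : ord0 = lshift (m + (m + k)) (0 : 'I_1) :> 'I_(1 + (m + (m + k))) by exact/val_inj.
  by rewrite ffunE; exact: (col_mxEu b _ 0 0).
have xf i : x (f i) = v1 i 0.
  by rewrite ffunE col_mxEd col_mxEu.
rewrite big_enum_cond /=; under eq_bigr do rewrite x0 xf.
rewrite !ffunE; have [j' ->|j' ->] := @split_ordP 1 (m + (m + k)) j.
  rewrite !col_mxEu big_pred0 ?addr0 // => i.
  by apply/eqP => /(congr1 val); rewrite /= (ord1 j').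
rewrite !col_mxEd; have [i ->|i ->] := split_ordP j'.
  rewrite !col_mxEu big_pred0 ?addr0 // => i'; exact: fg.
rewrite !col_mxEd; have [i' ->|i' ->] := split_ordP i.
  rewrite !col_mxEu [RHS]mxE [X in _ = _ + X]mxE (big_pred1 i') // => i''.
  by rewrite [LHS](inj_eq (@rshift_inj 1 (m + (m + k)))) eq_rshift eq_lshift.
rewrite !col_mxEd big_pred0 ?addr0 // => i''.
by rewrite [LHS](inj_eq (@rshift_inj 1 (m + (m + k)))) eq_rshift eq_lrshift.
Qed.

(** In the coordinates $(Rx,Qx,Sx)$, the map $x\mapsto x+CRx$ adds the first block to the second and
    fixes the others, so it is conjugate to the shear. *)
Lemma implementable_involution_basis n m k (C : 'M[bool]_(n, m))
    (R Q : 'M[bool]_(m, n)) (S : 'M[bool]_(k, n)) :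
  n = (m + (m + k))%N -> row_free (col_mx R (col_mx Q S)) ->
  R *m C = 0 -> Q *m C = 1%:M -> S *m C = 0 ->
  implementable 4 (2 * m) (1%:M + C *m R).
Proof.
move=> en; subst n; rewrite row_free_unit; set P := col_mx R _ => uP hR hQ hS.
apply: (implementable_conj uP).
rewrite [X in implementable _ _ X](_ : _ = 1%:M + shear_mx m k).
  exact: implementable_shear.
rewrite mulmxDr mulmx1 mulmxDl mulmxV //; congr (_ + _).
rewrite -[RHS](mulmxK uP); congr (_ *m _).
rewrite /P /shear_mx mul_block_col !mul0mx !addr0 mulmxA !mul_col_mx hR hQ hS.
by rewrite mul0mx.
Qed.

(** Factor $N=E-1$ through its rank as $CR$; then $N^2=0$ gives $RC=0$. [Q] is a left inverse of
    [C], and [S] completes [R] to a basis of the left kernel of [C]. *)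
Lemma implementable_involution n (E : 'M[bool]_n) :
  involution_mx E -> implementable 4 (2 * residue E) E.
Proof.
move=> hE; have N0 := involution_mx_sub1_sqr hE.
rewrite -[E in implementable _ _ E](subrK 1%:M) addrC /residue.
move: (E - 1%:M) N0 => N N0.
rewrite -[N in 1%:M + N](mulmx_base N).
set C := col_base N; set R := row_base N.
have fR : row_free R by exact: row_base_free.
have [Q QC] : exists Q, Q *m C = 1%:M by apply/row_fullP; exact: col_base_full.
have RC : R *m C = 0.
  apply: (row_free_inj fR); rewrite /= mul0mx.
  have : (C *m R) *m (C *m R) = 0 by rewrite mulmx_base.
  by rewrite -!mulmxA => CRCR; rewrite -[LHS]mul1mx -QC -!mulmxA CRCR mulmx0.
pose S := row_base (kermx C :\: R)%MS.
have SC : S *m C = 0.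
  by apply/sub_kermxP; rewrite eq_row_base diffmxSl.
have sR : (R <= kermx C)%MS by apply/sub_kermxP.
have fS : row_free S by exact: row_base_free.
have RS : (R :&: S)%MS = 0.
  by apply/eqP; rewrite -submx0 -(capmx_diff (kermx C) R) capmxC capmxS // eq_row_base.
apply: (@implementable_involution_basis _ _ _ C R Q S) => //.
- have := mxrank_cap_compl (kermx C) R.
  rewrite (capmx_idPr sR) (eqP fR) mxrank_ker => rk.
  have := mulmx0_rank_max RC; rewrite (eqP fR); move: rk.
  have /eqP -> : row_full C by exact: col_base_full.
  by lia.
(* In a relation $aR+bQ+cS=0$, multiplying by [C] leaves $b=0$; then $aR$ lies in the trivial
   intersection of [R] and [S]. *)
- rewrite -kermx_eq0; apply/rowV0P => X /sub_kermxP.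
  rewrite -[X]hsubmxK -[rsubmx X]hsubmxK; set a := lsubmx X.
  set b := lsubmx _; set c := rsubmx _; rewrite !mul_row_col => e0.
  have b0 : b = 0.
    have := congr1 (mulmx^~ C) e0; rewrite /= !mulmxDl.
    rewrite -(mulmxA a) -(mulmxA b) -(mulmxA c) RC QC SC !mulmx0.
    by rewrite add0r addr0 mulmx1 mul0mx.
  move: e0; rewrite b0 mul0mx add0r => /eqP; rewrite addr_eq0 oppmxb => /eqP e0.
  have aR : a *m R = 0.
    by apply/eqP; rewrite -submx0 -RS sub_capmx submxMl e0 submxMl.
  have -> : a = 0 by apply: (row_free_inj fR); rewrite aR mul0mx.
  have -> : c = 0 by apply: (row_free_inj fS); rewrite -e0 aR mul0mx.
  by rewrite !row_mx0.
Qed.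

(** Three involutions of depth 4 each give 12, and the counts add up to twice the sum of the
    residues. *)
Lemma unitmx_implementable n (A : 'M[bool]_n) :
  A \in unitmx -> implementable 12 (2 * n) A.
Proof.
move=> /unitmx_three_involutions [E [-> hE rE]].
have h i := implementable_involution (hE i).
have [c [hc dc mc ec]] := implementableM (implementableM (h 0) (h 1)) (h 2).
exists c; split=> //; apply: leq_trans mc _.
rewrite -!mulnDr leq_mul2l /=; apply: leq_trans rE.
rewrite !big_ord_recl big_ord0 addn0 addnA.
rewrite (_ : lift _ _ = 1); last exact/val_inj.
by rewrite (_ : lift _ _ = 2) //; apply/val_inj.
Qed.

(** * From unitaries to linear maps and back *)

Lemma cnot_circuit_fun n (u : circuit n) : cnot_circuit u ->
  exists2 A : 'M[bool]_n, A \in unitmx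
    & forall v, circuit_fun u (bits_of v) = bits_of (A *m v).
Proof.
elim: u => [_|g u IH /= /andP[hg /IH[A uA eA]]].
  by exists 1%:M; rewrite ?unitmx1 // => v; rewrite mul1mx.
case: g hg => // c t ne_ct _.
have tc : (delta_mx t 0 : 'cV[bool]_n) c 0 = 0 by rewrite mxE (negPf ne_ct).
(* A CNOT gate with control [c] and target [t] is the transvection $1+e_te_c^T$. *)
exists ((1%:M + (delta_mx t 0 : 'cV_n) *m delta_mx 0 c) *m A).
  by rewrite unitmx_mul uA andbT; have [] := mulmx1_unit (transvectionK tc).
move=> v; rewrite eA; apply/ffunP=> k; rewrite !ffunE -mulmxA mulmxDl mul1mx.
rewrite [RHS]mxE -mulmxA -rowE [X in _ + X]mxE big_ord1 !mxE eqxx andbT.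
by case: (k == t); rewrite ?mul1r // mul0r addr0.
Qed.

Lemma controlled_perm_op (C : numClosedFieldType) n (A : 'M[bool]_n)
    (f : bits n -> bits n) (F : bits n.+1 -> bits n.+1) :
  (forall v, f (bits_of v) = bits_of (A *m v)) ->
  (forall (b : 'M[bool]_1) v, F (bits_of (col_mx b v)) =
     bits_of (col_mx b (if b 0 0 then A *m v else v))) ->
  perm_op C F = controlled (perm_op C f).
Proof.
move=> ef eF; apply/matrixP=> i j; rewrite !mxE.
set x := enum_val i; set y := enum_val j.
pose t (z : bits n.+1) : 'cV[bool]_n := \col_k target_bits z k.
(* Every basis state splits into a control bit and a target vector, so the hypothesis on [F]
   determines it everywhere. *)
have decode (z : bits n.+1) : z = bits_of (col_mx (z ord0)%:M (t z)).
  apply/ffunP=> k; rewrite ffunE; have [k' ->|k' ->] := @split_ordP 1 n k.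
    by rewrite col_mxEu mxE !ord1 eqxx mulr1n; congr (z _); apply/val_inj.
  by rewrite col_mxEd mxE ffunE; congr (z _); apply/val_inj.
have tK z : target_bits z = bits_of (t z) by rewrite bits_ofK.
rewrite !enum_rankK !tK ef {1}(decode x) {1}(decode y) eF mxE eqxx mulr1n.
rewrite !(inj_eq (@bits_of_inj _)).
rewrite [LHS](_ : _ = ((x ord0 == y ord0) && (t x == if y ord0 then A *m t y else t y))%:R).
  by case: eqVneq => //= ->; case: (y ord0).
congr ((nat_of_bool _)%:R); apply/eqP/andP => [e|[/eqP -> /eqP ->] //].
have [/matrixP/(_ 0 0) exy ->] := @eq_col_mx bool 1 n 1 _ _ _ _ e.
by split=> //; move: exy; rewrite !mxE !eqxx !mulr1n => ->.
Qed.

Theorem theorem3 (R : realType) (n : nat) (n_ge1 : (1 <= n)%N)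
    (u : circuit n) (u_cnot : cnot_circuit u) :
  exists c : circuit n.+1,
    [/\ circuit_mx R[i] c = controlled (circuit_mx R[i] u),
        toffoli_depth_le 12 c
      & (toffoli_count c <= 2 * n)%N].
Proof.
have [A uA eA] := cnot_circuit_fun u_cnot.
have [c [hc dc mc ec]] := unitmx_implementable uA.
exists c; split=> //.
rewrite (circuit_mx_classical _ hc) (circuit_mx_classical _ (cnot_classical u_cnot)).
exact: controlled_perm_op eA ec.
Qed.
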